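(* Let $X$ be a $G$-space and let $f:X\rightarrow X$ be continuous. If $f$ is strongly $G$-mixing, then $f$ is weakly $G$-mixing.
   Context: A $G$-space $X$ is a topological space $X$ together with a topological group $G$ and a continuous action $G\times X\to X$, $(g,x)\mapsto g.x$. For $A\subseteq X$, $g.A=\{g.a:a\in A\}$. $\mathbb{N}$ is the set of positive integers and $f^k$ is the $k$-th iterate of $f$. A continuous map $f:X\to X$ is strongly $G$-mixing if for any pair of nonempty open subsets $U,V$ of $X$ there exists $N\in\mathbb{N}$ such that for all $n\geqslant N$ there is $g_n\in G$ with $g_n.f^n(U)\cap V\neq\emptyset$. A continuous map $f:X\to X$ is $G$-transitive if for any pair of nonempty open subsets $U,V$ of $X$ there exist $g\in G$ and $k\in\mathbb{N}$ with $g.f^k(U)\cap V\neq\emptyset$. The product $X\times X$ is a $G\times G$-space under $(g,h).(x,y)=(g.x,h.y)$. A continuous map $f:X\to X$ is weakly $G$-mixing if $f\times f$ is $G\times G$-transitive on $X\times X$; equivalently, for all nonempty open $U,V,E,F\subseteq X$ there exist $(g,h)\in G\times G$ and $k\in\mathbb{N}$ such that $g.f^k(U)\cap E\neq\emptyset$ and $h.f^k(V)\cap F\neq\emptyset$. *)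

(* Defs.v *)
From HB Require Import structures.
From mathcomp Require Import all_boot all_order all_algebra.
From mathcomp Require Import all_classical.
From mathcomp Require Import topology.

Set Implicit Arguments.
Unset Strict Implicit.
Unset Printing Implicit Defensive.

Local Open Scope classical_set_scope.
Local Open Scope group_scope.

HB.mixin Record isTopologicalGroup G & Topological G & Group G := {
  mulg_continuous : continuous (fun x : G * G => x.1 * x.2);
  invg_continuous : continuous (fun x : G => x^-1)
}.

#[short(type="topologicalGroupType")]
HB.structure Definition TopologicalGroup :=
  {G of Topological G & Group G & isTopologicalGroup G}.

HB.mixin Record Topological_isGSpace (G : topologicalGroupType) X
    & Topological X := {
  gact : G -> X -> X;
  gact1 : forall x, gact 1 x = x;
  gactM : forall g h x, gact (g * h) x = gact g (gact h x);
  gact_continuous : continuous (fun p : G * X => gact p.1 p.2)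
}.

#[short(type="gSpaceType")]
HB.structure Definition GSpace (G : topologicalGroupType) :=
  {X of Topological X & Topological_isGSpace G X}.

Section ProductGroup.
Variables G H : topologicalGroupType.

Let mul_continuous :
  continuous (fun x : (G * H) * (G * H) => x.1 * x.2).
Proof.
move=> x; apply: cvg_pair.
- apply: (continuous_comp (f := fun x : (G * H) * (G * H) => (x.1.1, x.2.1))
    (g := fun x => x.1 * x.2)); last exact: mulg_continuous.
  by apply: cvg_pair; apply: continuous_comp;
    [exact: cvg_fst|exact: cvg_fst|exact: cvg_snd|exact: cvg_fst].
- apply: (continuous_comp (f := fun x : (G * H) * (G * H) => (x.1.2, x.2.2))
    (g := fun x => x.1 * x.2)); last exact: mulg_continuous.
  by apply: cvg_pair; apply: continuous_comp;
    [exact: cvg_fst|exact: cvg_snd|exact: cvg_snd|exact: cvg_snd].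
Qed.

Let inv_continuous : continuous (fun x : G * H => x^-1).
Proof.
move=> x; apply: cvg_pair.
- by apply: continuous_comp; [exact: cvg_fst|exact: invg_continuous].
- by apply: continuous_comp; [exact: cvg_snd|exact: invg_continuous].
Qed.

HB.instance Definition _ :=
  isTopologicalGroup.Build (G * H)%type mul_continuous inv_continuous.

End ProductGroup.

Section ProductGSpace.
Variables (G H : topologicalGroupType) (X : gSpaceType G) (Y : gSpaceType H).

Definition prod_gact (g : G * H) (x : X * Y) : X * Y :=
  (gact g.1 x.1, gact g.2 x.2).

Let prod_gact1 x : prod_gact 1 x = x.
Proof. by case: x => x y; rewrite /prod_gact /= !gact1. Qed.

Let prod_gactM g h x : prod_gact (g * h) x = prod_gact g (prod_gact h x).
Proof. by rewrite /prod_gact /= !gactM. Qed.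

Let prod_gact_continuous :
  continuous (fun p : (G * H) * (X * Y) => prod_gact p.1 p.2).
Proof.
move=> x; apply: cvg_pair.
- apply: (continuous_comp (f := fun x : (G * H) * (X * Y) => (x.1.1, x.2.1))
    (g := fun p : G * X => gact p.1 p.2)); last exact: gact_continuous.
  by apply: cvg_pair; apply: continuous_comp;
    [exact: cvg_fst|exact: cvg_fst|exact: cvg_snd|exact: cvg_fst].
- apply: (continuous_comp (f := fun x : (G * H) * (X * Y) => (x.1.2, x.2.2))
    (g := fun p : H * Y => gact p.1 p.2)); last exact: gact_continuous.
  by apply: cvg_pair; apply: continuous_comp;
    [exact: cvg_fst|exact: cvg_snd|exact: cvg_snd|exact: cvg_snd].
Qed.

HB.instance Definition _ := Topological_isGSpace.Build (G * H)%type (X * Y)%type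
  prod_gact1 prod_gactM prod_gact_continuous.

End ProductGSpace.

(* The mixing notions below are predicates on arbitrary self-maps; continuity
   of the map is a separate hypothesis. Times are positive integers. *)
Section Mixing.
Variables (G : topologicalGroupType) (X : gSpaceType G).
Implicit Types f : X -> X.

Definition strongly_gmixing f :=
  forall U V : set X, open U -> U !=set0 -> open V -> V !=set0 ->
  exists2 N : nat, (0 < N)%N &
    forall n : nat, (N <= n)%N ->
    exists g : G, (gact g @` (iter n f @` U)) `&` V !=set0.

Definition gtransitive f :=
  forall U V : set X, open U -> U !=set0 -> open V -> V !=set0 ->
  exists (g : G) (k : nat),
    (0 < k)%N /\ (gact g @` (iter k f @` U)) `&` V !=set0.

End Mixing.

Definition weakly_gmixing (G : topologicalGroupType) (X : gSpaceType G)
    (f : X -> X) :=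
  @gtransitive (G * G)%type (X * X)%type (fun p => (f p.1, f p.2)).

(* Main.v *)
Require Import Defs.
From mathcomp Require Import all_boot all_order all_algebra.
From mathcomp Require Import all_classical.
From mathcomp Require Import topology.

Local Open Scope classical_set_scope.

(** Every nonempty open subset of the square contains a nonempty open box ([open_prod_box]), and the
    product map iterates coordinatewise ([iter_prod_map]), so the problem splits into one strong
    mixing condition per coordinate. Each condition holds at all times past its own threshold, hence
    both hold at a common time; the two group elements may differ because [G * G] acts. *)

Lemma open_prod_box {X Y : topologicalType} {W : set (X * Y)} :
  open W -> W !=set0 ->
  exists A B, [/\ open A, A !=set0, open B, B !=set0 & A `*` B `<=` W].
Proof.
move=> Wo [[x y] Wxy].
have [[A B] /= [xA yB] ABW] : nbhs (x, y) W by exact: open_nbhs_nbhs.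
(* The factors of a product neighbourhood need not be open; their interiors are, and still contain
   [x] and [y]. *)
exists A°, B°; split; try exact: open_interior.
- by exists x.
- by exists y.
- by move=> [a b] [/= /interior_subset Aa /interior_subset Bb]; exact: ABW.
Qed.

Lemma iter_prod_map (X Y : Type) (f : X -> X) (g : Y -> Y) n (p : X * Y) :
  iter n (fun q => (f q.1, g q.2)) p = (iter n f p.1, iter n g p.2).
Proof. by elim: n => [|n IHn]; [case: p|rewrite !iterS IHn]. Qed.

Theorem proposition2p7 (G : topologicalGroupType) (X : gSpaceType G)
    (f : X -> X) (f_continuous : continuous f) :
  strongly_gmixing f -> weakly_gmixing f.
Proof.
move=> mix W W' Wo W0 W'o W'0.
have [U [V [Uo U0 Vo V0 UVW]]] := open_prod_box Wo W0.
have [E [F [Eo E0 Fo F0 EFW']]] := open_prod_box W'o W'0.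
have [N1 N1_gt0 mixUE] := mix U E Uo U0 Eo E0.
have [N2 _ mixVF] := mix V F Vo V0 Fo F0.
(* Both coordinates must use the same number of iterations: [maxn N1 N2] is past both thresholds. *)
have [g [_ [[_ [u Uu <-] <-] Eu]]] := mixUE _ (leq_maxl N1 N2).
have [h [_ [[_ [v Vv <-] <-] Fv]]] := mixVF _ (leq_maxr N1 N2).
exists (g, h), (maxn N1 N2); split; first by rewrite leq_max N1_gt0.
exists (gact g (iter (maxn N1 N2) f u), gact h (iter (maxn N1 N2) f v)).
split; last exact: EFW'.
exists (iter (maxn N1 N2) f u, iter (maxn N1 N2) f v) => //.
by exists (u, v); [exact: UVW|rewrite iter_prod_map].
Qed.
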